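(* Suppose that $n=2k$, where $k\geq 2$ is an integer, and let $G=(U_1\times U_2)\rtimes S_n$. Define a map $\tau_1:G\to G$ by the rules (on generators of $G$) $$b_{i,j}^{\tau_1}=b_{i,j},\quad c_{i,j}^{\tau_1}=d_{i,j},\quad d_{i,j}^{\tau_1}=c_{i,j},\quad e_{i,j}^{\tau_1}=e_{i,j}\qquad(1\le i<j\le n).$$ Let $\tau_2$ be the inner automorphism of $G$ corresponding to the element $\sigma=(1,2)(3,4)\cdots(2k-1,2k)\in S_n$, and put $\tau=\tau_1\tau_2$. Then the following statements hold. (i) $\tau_1$ and $\tau$ are involutory automorphisms (automorphisms of order 2) of $G$. (ii) If $H=\langle\tau\rangle$ and $M=M_\eta(G,D)$, then the flip subalgebra $A=A(\tau)$ coincides with the fixed subalgebra $M_H$ and has dimension $4k^2-k$. Among the $H$-orbit vectors, there are $2k$ singles and $4k^2-3k$ doubles.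
   Context: Let $V_1,V_2$ be $n$-dimensional vector spaces over the field of order 2 with bases $e_1,\dots,e_n$ and $f_1,\dots,f_n$, on which $S_n$ acts by $e_i^\pi=e_{i^\pi}$, $f_i^\pi=f_{i^\pi}$. Let $U_1=\langle e_i+e_{i+1}\mid 1\le i\le n-1\rangle$ and $U_2=\langle f_i+f_{i+1}\mid 1\le i\le n-1\rangle$; these are $S_n$-invariant, and $G=(U_1\times U_2)\rtimes S_n$ is the natural semidirect product. For $1\le i<j\le n$ put $b_{i,j}=b_{j,i}=(i,j)$, $c_{i,j}=c_{j,i}=(e_i+e_j)(i,j)$, $d_{i,j}=d_{j,i}=(f_i+f_j)(i,j)$, $e_{i,j}=e_{j,i}=(e_i+e_j)(f_i+f_j)(i,j)$. These $2n(n-1)$ elements form a generating set $D$ of $G$ and $(G,D)$ is a 3-transposition group (i.e. $D$ is a normal generating set of involutions of $G$ with $|cd|\le 3$ for all $c,d\in D$). Let $\mathbb{F}$ be a field of characteristic not two and $\eta\in\mathbb{F}\setminus\{0,1\}$. The Matsuo algebra $M_\eta(G,D)$ is the commutative $\mathbb{F}$-algebra with basis $D$ and product $c\cdot c=c$; $c\cdot d=0$ if $|cd|=2$; $c\cdot d=\frac{\eta}{2}(c+d-c^d)$ if $|cd|=3$. The Fischer space has point set $D$ and lines $\{c,d,c^d\}$ for $c,d\in D$ with $|cd|=3$. Automorphisms of the Fischer space (in particular automorphisms of $G$ preserving $D$) act on $M_\eta(G,D)$ by permuting the basis $D$. For a group $H$ of such automorphisms the fixed subalgebra is $M_H=\{u\in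 M\mid u^h=u \text{ for all } h\in H\}$; the orbit vectors $\sum_{c\in O}c$, for $O$ an $H$-orbit on $D$, form a basis of $M_H$. If $H=\langle\tau\rangle$ with $|\tau|=2$, an orbit vector is called a single if it is $a\in D$ with $\{a\}$ an orbit of length 1; a double if it is $a+b$ with $\{a,b\}$ an orbit of length 2 and $a\cdot b=0$; an extra if it is $a+b$ with $\{a,b\}$ an orbit of length 2 and $a\cdot b\ne0$. The flip subalgebra $A(\tau)$ is the subalgebra of $M_H$ generated by all singles and all doubles. *)

(* Defs.v *)
From HB Require Import structures.
From mathcomp Require Import all_boot all_order all_algebra all_fingroup.

Set Implicit Arguments.
Unset Strict Implicit.
Unset Printing Implicit Defensive.

Import GRing.Theory.
Local Open Scope ring_scope.

(* Indices are 0-based: the point i of {1, ..., n} is the ordinal i - 1 of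
   'I_n, so that (1,2)(3,4)... becomes (0 1)(2 3)...                          *)

Section Group.

Variable n : nat.

Definition evec (i : 'I_n) : 'rV['F_2]_n := delta_mx 0 i.

Definition Uspace : {vspace 'rV['F_2]_n} :=
  span [seq evec p.1 + evec p.2 |
      p : 'I_n * 'I_n <- enum [pred p : 'I_n * 'I_n | p.2 == p.1.+1 :> nat]].

Definition Uset : {set 'rV['F_2]_n} := [set v | v \in Uspace].

Lemma Uset_group : group_set Uset.
Proof.
apply/group_setP; split=> [|u v]; rewrite !inE; first exact: mem0v.
exact: memvD.
Qed.
Canonical U_group := Group Uset_group.

(* V_1 and V_2 (hence U_1 and U_2) are both realised inside 'rV['F_2]_n, and
   V_1 x V_2 as pairs. The products of mathcomp permutations are read from left to right, so v |-> v *m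
   perm_mx s is a right action, and it maps e_i to e_(s i).                   *)
Local Notation VV := ('rV['F_2]_n * 'rV['F_2]_n)%type.

Definition vact (v : VV) (s : 'S_n) : VV := (v.1 *m perm_mx s, v.2 *m perm_mx s).

Lemma evec_act i (s : 'S_n) : evec i *m perm_mx s = evec (s i).
Proof. by rewrite /evec -rowE; apply/rowP=> j; rewrite !mxE eqxx /= eq_sym. Qed.

Fact vact1 : vact^~ 1%g =1 id.
Proof. by case=> u v; rewrite /vact perm_mx1 !mulmx1. Qed.

Fact vactM v : act_morph vact v.
Proof. by case: v => u v s t; rewrite /vact perm_mxM !mulmxA. Qed.

Canonical vaction := TotalAction vact1 vactM.

Fact vact_is_groupAction : is_groupAction [set: VV] vaction.
Proof.
move=> s _; rewrite inE; apply/andP; split.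
  by apply/subsetP=> v _; rewrite inE.
by apply/morphicP=> u v _ _; rewrite !actpermE /= /vact !mulmxDl.
Qed.
Canonical vgroupAction := GroupAction vact_is_groupAction.

Definition UU : {group VV} := setX_group U_group U_group.

Lemma addvv (v : 'rV['F_2]_n) : v + v = 0.
Proof.
apply/rowP=> j; rewrite !mxE; move: (v 0 j) => x.
by apply/val_inj; case: x => [[|[|]]].
Qed.

Lemma evecD_U i j : evec i + evec j \in Uset.
Proof.
rewrite inE; wlog le_ij : i j / (i <= j)%N.
  by move=> IH; case/orP: (leq_total i j) => /IH //; rewrite addrC.
case: j le_ij => m lt_mn /=; elim: m lt_mn => [|m IHm] lt_mn.
  rewrite leqn0 => /eqP i0; rewrite [Ordinal _](_ : _ = i); last exact: val_inj.
  by rewrite addvv mem0v.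
rewrite leq_eqVlt => /orP[/eqP im|lt_im].
  rewrite [Ordinal _](_ : _ = i); last exact: val_inj.
  by rewrite addvv mem0v.
have lt_m : (m < n)%N by apply: ltnW.
have Ha := IHm lt_m lt_im.
have Hb : evec (Ordinal lt_m) + evec (Ordinal lt_mn) \in Uspace.
  apply: memv_span; apply/mapP; exists (Ordinal lt_m, Ordinal lt_mn) => //.
  by rewrite mem_enum inE /=.
by have := memvD Ha Hb; rewrite addrA -(addrA (evec i)) addvv addr0.
Qed.

Lemma U_act (v : 'rV['F_2]_n) (s : 'S_n) :
  v \in Uset -> v *m perm_mx s \in Uset.
Proof.
rewrite inE => /coord_span ->; rewrite mulmx_suml inE.
apply: rpred_sum => i _; rewrite -scalemxAl; apply: rpredZ.
set X := map_tuple _ _; have X_i : X`_i \in X.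
  by apply: mem_nth; rewrite size_tuple.
have /mapP[[a b] _ ->] := X_i.
have := evecD_U (s a) (s b); rewrite inE.
by rewrite mulmxDl !evec_act.
Qed.

Lemma UU_acts : {acts [set: 'S_n], on group UU | vgroupAction}.
Proof.
split; last by apply/subsetP=> v _; rewrite inE.
rewrite /actby_cond; apply/subsetP=> s _.
rewrite inE in_setT; rewrite inE; apply/subsetP=> -[u v].
by rewrite !inE /= -![_ \in Uspace]/(_ \in Uspace) => /andP[Hu Hv];
  have := U_act s (v := u); have := U_act s (v := v); rewrite !inE Hu Hv
  => -> // ->.
Qed.

Definition UUaction := <[UU_acts]>%gact.

(* G = (U_1 x U_2) : S_n, as the full type of the external semidirect product *)
Definition Gn : finGroupType := sdprod_by UUaction.

Definition inU (w : VV) : Gn := sdpair1 UUaction w.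
Definition inS (s : 'S_n) : Gn := sdpair2 UUaction s.

Definition bG (i j : 'I_n) : Gn := inS (tperm i j).
Definition cG (i j : 'I_n) : Gn :=
  (inU (evec i + evec j, 0) * inS (tperm i j))%g.
Definition dG (i j : 'I_n) : Gn :=
  (inU (0, evec i + evec j) * inS (tperm i j))%g.
Definition eG (i j : 'I_n) : Gn :=
  (inU (evec i + evec j, 0) * inU (0, evec i + evec j) * inS (tperm i j))%g.

Definition DG : {set Gn} :=
  \bigcup_(p : 'I_n * 'I_n | (p.1 < p.2)%N)
    [set bG p.1 p.2; cG p.1 p.2; dG p.1 p.2; eG p.1 p.2].

Definition tau1_rules (f : Gn -> Gn) : Prop :=
  forall i j : 'I_n, (i < j)%N ->
    [/\ f (bG i j) = bG i j, f (cG i j) = dG i j,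
        f (dG i j) = cG i j & f (eG i j) = eG i j].

End Group.

Section Sigma.

Variable k : nat.

Fact dbl_lt (j : 'I_k) : (2 * j < 2 * k)%N.
Proof. by rewrite ltn_pmul2l. Qed.

Fact dblS_lt (j : 'I_k) : (2 * j + 1 < 2 * k)%N.
Proof. by rewrite addn1 !mul2n ltn_Sdouble. Qed.

Definition sigma : 'S_(2 * k) :=
  (\prod_(j < k) tperm (Ordinal (dbl_lt j)) (Ordinal (dblS_lt j)))%g.

End Sigma.

Section Matsuo.

Variables (F : fieldType) (eta : F) (gT : finGroupType) (D : {set gT}).

Definition matsuo : vectType F := {ffun {x : gT | x \in D} -> F^o}.

(* The basis vector x if x \in D, and 0 otherwise. *)
Definition mpt (x : gT) : matsuo := [ffun c => (val c == x)%:R].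

(* When D is a set of 3-transpositions, the last case is |cd| = 2. *)
Definition pt_mul (c d : gT) : matsuo :=
  if c == d then mpt c
  else if #[c * d]%g == 3 then
    (eta / 2%:R) *: (mpt c + mpt d - mpt (c ^ d)%g)
  else 0.

Definition matsuo_mul (u v : matsuo) : matsuo :=
  \sum_c \sum_d (u c * v d) *: pt_mul (val c) (val d).

Definition is_subalg (U : {vspace matsuo}) : Prop :=
  forall u v, u \in U -> v \in U -> matsuo_mul u v \in U.

Definition mul_span (U : {vspace matsuo}) : {vspace matsuo} :=
  <<[seq matsuo_mul u v | u <- vbasis U, v <- vbasis U]>>%VS.

(* The subalgebra generated by X; see subalg_genP. *)
Definition subalg_gen (X : seq matsuo) : {vspace matsuo} :=
  iter (\dim {: matsuo}) (fun U => U + mul_span U)%VS <<X>>%VS.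

Fact matsuo_mul_is_linear_l v : linear (matsuo_mul^~ v).
Proof.
move=> a u u'; rewrite /matsuo_mul scaler_sumr -big_split /=.
apply: eq_bigr => c _; rewrite scaler_sumr -big_split /=.
apply: eq_bigr => d _; rewrite !ffunE mulrDl scalerDl.
by rewrite scalerA mulrA.
Qed.

Fact matsuo_mul_is_linear_r u : linear (matsuo_mul u).
Proof.
move=> a v v'; rewrite /matsuo_mul scaler_sumr -big_split /=.
apply: eq_bigr => c _; rewrite scaler_sumr -big_split /=.
apply: eq_bigr => d _; rewrite !ffunE mulrDr scalerDl scalerA.
by congr (_ *: _ + _); exact: mulrCA.
Qed.

Lemma mul_spanP (U W : {vspace matsuo}) :
  (forall u v, u \in U -> v \in U -> matsuo_mul u v \in W) <->
  (mul_span U <= W)%VS.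
Proof.
split=> [UW | sUW u v Uu Uv].
  apply/span_subvP=> _ /allpairsP[[u v] /= [Uu Uv ->]].
  by apply: UW; exact: vbasis_mem.
pose ml v := HB.pack_for {linear matsuo -> matsuo} (matsuo_mul^~ v)
  (GRing.isLinear.Build _ _ _ _ _ (matsuo_mul_is_linear_l v)).
pose mr u := HB.pack_for {linear matsuo -> matsuo} (matsuo_mul u)
  (GRing.isLinear.Build _ _ _ _ _ (matsuo_mul_is_linear_r u)).
rewrite (coord_vbasis Uu) -[matsuo_mul _ v]/(ml v _) linear_sum.
apply: memv_suml => i _; rewrite linearZ; apply: memvZ => /=.
rewrite (coord_vbasis Uv) -[matsuo_mul _ _]/(mr _ _) linear_sum.
apply: memv_suml => j _; rewrite linearZ; apply: memvZ => /=.
by apply/(subvP sUW)/memv_span/allpairs_f; apply: mem_nth; rewrite size_tuple.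
Qed.

Lemma subalg_genP (X : seq matsuo) :
  [/\ {subset X <= subalg_gen X}, is_subalg (subalg_gen X)
    & forall U, is_subalg U -> {subset X <= U} -> (subalg_gen X <= U)%VS].
Proof.
pose g (U : {vspace matsuo}) := (U + mul_span U)%VS.
have sg U : (U <= g U)%VS by exact: addvSl.
have ltg U : g U != U -> (\dim U < \dim (g U))%N.
  by rewrite eq_sym eqEdim sg -ltnNge.
rewrite /subalg_gen -/g; split=> [u Xu | | U aU sXU].
- elim: (\dim _) => [|m IHm]; first exact: memv_span.
  exact: (subvP (sg _)).
- suff fixg : g (iter (\dim {: matsuo}) g <<X>>%VS)
              = iter (\dim {: matsuo}) g <<X>>%VS.
    by apply/mul_spanP; rewrite -{2}fixg addvSr.
  have grow m : g (iter m g <<X>>%VS) = iter m g <<X>>%VS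
                \/ (m < \dim (iter m.+1 g <<X>>%VS))%N.
    elim: m => [|m [IHm|IHm]].
    + have [->|ne] := eqVneq (g <<X>>%VS) <<X>>%VS; first by left.
      by right; exact: leq_ltn_trans (leq0n _) (ltg _ ne).
    + by left; rewrite /= !IHm.
    + have [->|ne] := eqVneq (g (iter m.+1 g <<X>>%VS)) (iter m.+1 g <<X>>%VS).
        by left.
      by right; exact: leq_ltn_trans IHm (ltg _ ne).
  by case: (grow (\dim {: matsuo})) => //; rewrite ltnNge dimvS ?subvf.
- elim: (\dim _) => [|m IHm]; first by apply/span_subvP=> u /sXU.
  rewrite /= subv_add IHm /=; apply/mul_spanP=> u v /(subvP IHm) Uu.
  by move=> /(subvP IHm); exact: aU.
Qed.

(* u^h, for a permutation h of gT that preserves D *)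
Definition mact (h : {perm gT}) (u : matsuo) : matsuo :=
  \sum_c u c *: mpt (h (val c)).

Fact mact_is_linear h : linear (mact h).
Proof.
move=> a u v; rewrite /mact scaler_sumr -big_split /=.
by apply: eq_bigr => c _; rewrite !ffunE scalerDl scalerA.
Qed.
HB.instance Definition _ h :=
  GRing.isLinear.Build F matsuo matsuo _ (mact h) (mact_is_linear h).

Definition fixed_subalg (H : {set {perm gT}}) : {vspace matsuo} :=
  (\bigcap_(h in H) fixedSpace (linfun (mact h)))%VS.

Lemma fixed_subalgP (H : {set {perm gT}}) u :
  reflect (forall h, h \in H -> mact h u = u) (u \in fixed_subalg H).
Proof.
apply: (iffP idP) => [Mu h Hh | fixu].
  move: Mu; rewrite /fixed_subalg (bigD1 h) //= memv_cap => /andP[/fixedSpaceP].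
  by rewrite lfunE.
by rewrite memvE; apply/subv_bigcapP=> h Hh; rewrite -memvE;
   apply/fixedSpaceP; rewrite lfunE; exact: fixu.
Qed.

Definition orbit_vec (B : {set gT}) : matsuo := \sum_(x in B) mpt x.

(* Distinct orbits have distinct vectors, so undup removes nothing. *)
Definition orbit_vecs (H : {set {perm gT}}) : seq matsuo :=
  undup [seq orbit_vec B | B <- enum (orbit 'P H @: D)].

Definition is_single (H : {set {perm gT}}) (u : matsuo) : bool :=
  [exists a in D, (orbit 'P H a == [set a]) && (u == mpt a)].

Definition is_double (H : {set {perm gT}}) (u : matsuo) : bool :=
  [exists a in D, exists b in D,
    [&& a != b, orbit 'P H a == [set a; b], u == mpt a + mpt b
      & matsuo_mul (mpt a) (mpt b) == 0]].

Definition singles H := filter (is_single H) (orbit_vecs H).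
Definition doubles H := filter (is_double H) (orbit_vecs H).

Definition flip_subalg (tau : {perm gT}) : {vspace matsuo} :=
  subalg_gen (singles <[tau]>%g ++ doubles <[tau]>%g).

End Matsuo.

(* Main.v *)
Require Import Defs.
From mathcomp Require Import all_boot all_order all_algebra all_fingroup.
From HB Require Import structures.
From mathcomp Require Import cyclic zify.

(** The automorphism tau1 exchanges the two modules U_1 and U_2 of G and fixes
    the complement S_n pointwise. It commutes with conjugation by the
    involution sigma of S_n, so tau = tau1 tau2 is an involution as well. Since
    D generates G, tau1 is determined by its values on D.

    Everything else follows from the action of tau on D. All elements of D
    are written uniformly as transp e d i j, that is
    (e_i + e_j)^e (f_i + f_j)^d (i,j) with exponents e and d in {0,1}. Then tau
    maps transp e d i j to transp d e (sigma i) (sigma j) (flip_transp).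
    As sigma has no fixed point, either sigma exchanges i and j, and the
    element and its image have the same underlying transposition (i,j), or
    the two underlying transpositions are disjoint. In both cases the
    element commutes with its image (flip_commute). So no H-orbit of length
    two is an extra: every orbit vector is a single or a double. The orbit
    vectors form a basis of the fixed subalgebra M_H (free_orbit_vecs,
    fixed_subalg_span), hence the singles and doubles already span M_H, and
    M_H is closed under products because tau acts by algebra automorphisms
    (mact_mul); this gives A(tau) = M_H (flip_subalg_fixed).

    It remains to count. The fixed points of tau on D are the
    transp e e i (sigma i), which gives n = 2k singles (card_flip_fixed). As
    #|D| = 2n(n-1) = 8k^2 - 4k, there are (8k^2 - 6k)/2 = 4k^2 - 3k orbits of
    length two, and dim M_H is the sum 4k^2 - k. *)

Set Implicit Arguments.
Unset Strict Implicit.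
Unset Printing Implicit Defensive.

Import GRing.Theory.
Local Open Scope ring_scope.

(** * Fixed subalgebras of Matsuo algebras *)

Section Matsuo.

Variables (F : fieldType) (eta : F) (gT : finGroupType) (D : {set gT}).

Local Notation M := (matsuo F D).
Local Notation mact := Defs.mact.
Local Arguments Defs.mact : simpl never.
Local Arguments matsuo_mul : simpl never.
Local Notation mpt := (mpt F D).

Lemma mpt_out x : x \notin D -> mpt x = 0.
Proof.
move=> Dx; apply/ffunP=> c; rewrite !ffunE; case: eqP => // cx.
by rewrite -cx (valP c) in Dx.
Qed.

Lemma sum_mpt (u : M) : \sum_c u c *: mpt (val c) = u.
Proof.
apply/ffunP=> d; rewrite sum_ffunE (bigD1 d) //= big1 => [|c ne_cd].
  by rewrite !ffunE eqxx addr0; exact: mulr1.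
by rewrite !ffunE eq_sym val_eqE (negPf ne_cd); exact: mulr0.
Qed.

Lemma matsuo_mul_mpt a b :
  a \in D -> b \in D -> matsuo_mul eta (mpt a) (mpt b) = pt_mul eta D a b.
Proof.
move=> Da Db; rewrite /matsuo_mul (bigD1 (exist _ a Da)) //=.
rewrite [X in _ + X]big1 => [|c ne]; last first.
  apply: big1 => d _; rewrite !ffunE (negPf (_ : val c != a)) ?mul0r ?scale0r //.
rewrite addr0 (bigD1 (exist _ b Db)) //= big1 => [|c ne].
  by rewrite !ffunE /= !eqxx mulr1 scale1r addr0.
by rewrite !ffunE /= [val c == b](negPf ne) mulr0 scale0r.
Qed.

Lemma matsuo_mul_sum (I : finType) (a b : I -> F) (x y : I -> M) :
  matsuo_mul eta (\sum_i a i *: x i) (\sum_j b j *: y j) =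
  \sum_i \sum_j (a i * b j) *: matsuo_mul eta (x i) (y j).
Proof.
pose ml (v : M) := HB.pack_for {linear M -> M} (fun u => matsuo_mul eta u v)
  (GRing.isLinear.Build _ _ _ _ _ (matsuo_mul_is_linear_l eta v)).
pose mr (u : M) := HB.pack_for {linear M -> M} (fun v => matsuo_mul eta u v)
  (GRing.isLinear.Build _ _ _ _ _ (matsuo_mul_is_linear_r eta u)).
rewrite -[LHS]/(ml _ _) linear_sum; apply: eq_bigr => i _.
rewrite linearZ -[LHS]/(a i *: mr _ _) [mr _ _]linear_sum scaler_sumr.
by apply: eq_bigr => j _; rewrite linearZ scalerA.
Qed.

(** Outside D both sides vanish, so the formula also covers the term c^d of a
    product, wherever that element lies. *)
Lemma mact_mpt (h : {perm gT}) (x : gT) :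
  (forall y, (h y \in D) = (y \in D)) -> mact h (mpt x) = mpt (h x).
Proof.
move=> hD; case Dx: (x \in D); last first.
  by rewrite !mpt_out ?linear0 ?hD ?Dx.
rewrite /mact (bigD1 (exist _ x Dx)) //= big1 => [|c ne].
  by rewrite !ffunE /= eqxx scale1r addr0.
by rewrite !ffunE /= [val c == x](negPf ne) scale0r.
Qed.

(** The product of two points of D depends only on the order of their product
    and on a conjugate, both of which a group automorphism preserves. *)
Lemma mact_mul (h : {perm gT}) u v :
    h \in Aut [set: gT] -> (forall y, (h y \in D) = (y \in D)) ->
  mact h (matsuo_mul eta u v) = matsuo_mul eta (mact h u) (mact h v) :> M.
Proof.
move=> hA hD; pose f := autm hA.
have fE x : h x = f x by rewrite /f /= autmE.
have f_pt a b : mact h (pt_mul eta D a b) = pt_mul eta D (h a) (h b).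
  rewrite /pt_mul (inj_eq perm_inj).
  have [-> | _] := eqVneq a b; first exact: mact_mpt.
  have -> : #[h a * h b]%g = #[a * b]%g.
    by rewrite !fE -morphM ?inE // order_injm ?inE // injm_autm.
  case: ifP => _; last exact: linear0.
  rewrite linearZ linearB linearD /= !mact_mpt //; congr (_ *: (_ - mpt _)).
  by rewrite !fE -morphJ ?inE.
rewrite -[u in LHS]sum_mpt -[v in LHS]sum_mpt matsuo_mul_sum /mact.
rewrite matsuo_mul_sum -/(mact h _) linear_sum; apply: eq_bigr => c _.
rewrite linear_sum; apply: eq_bigr => d _.
rewrite linearZ !matsuo_mul_mpt ?hD ?(valP c) ?(valP d) //.
by rewrite -f_pt.
Qed.

Section FixedSubalgebra.

Variable H : {group {perm gT}}.
Hypothesis actsHD : [acts H, on D | 'P].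

Let hD h : h \in H -> forall y, (h y \in D) = (y \in D).
Proof. by move=> Hh y; rewrite -[h y]/('P%act y h) (actsP actsHD). Qed.

Lemma fixed_subalg_is_subalg :
  H \subset Aut [set: gT] -> is_subalg eta (fixed_subalg F D H).
Proof.
move=> sHA u v /fixed_subalgP fix_u /fixed_subalgP fix_v.
apply/fixed_subalgP=> h Hh.
by rewrite mact_mul ?(subsetP sHA) ?fix_u ?fix_v //; exact: hD.
Qed.

Local Notation orbits := (orbit 'P H @: D).
Local Notation orbit_vec := (orbit_vec F D).

Lemma orbit_vecE (B : {set gT}) c : orbit_vec B c = (val c \in B)%:R.
Proof.
rewrite /orbit_vec sum_ffunE.
have [Bc | Bc] := boolP (val c \in B).
  rewrite (bigD1 (val c)) //= big1 => [|x /andP[_ ne]]; rewrite ffunE.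
    by rewrite eqxx addr0.
  by rewrite eq_sym (negPf ne).
rewrite big1 // => x Bx; rewrite ffunE; case: eqP => // cx.
by rewrite cx Bx in Bc.
Qed.

Lemma orbit_vec_fixed B : B \in orbits -> orbit_vec B \in fixed_subalg F D H.
Proof.
case/imsetP=> a Da ->; apply/fixed_subalgP=> h Hh.
rewrite /orbit_vec linear_sum [RHS](reindex_acts 'P _ Hh) /=; last first.
  exact: acts_orbit (subsetT _).
by apply: eq_bigr => x _; rewrite mact_mpt //; exact: hD.
Qed.

(** Distinct orbits are disjoint and non-empty, so evaluating a linear relation
    at a point of one orbit isolates the coefficient of that orbit. *)
Lemma free_orbit_vecs : free [seq orbit_vec B | B <- enum orbits].
Proof.
have /and3P[/eqP covD tiP P0] := orbit_partition actsHD.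
set s := enum orbits; rewrite -[map _ _]in_tupleE; apply/freeP=> a sum0 i.
have lt_i : (i < size s)%N by rewrite -(size_map orbit_vec) ltn_ord.
set B := nth set0 s i; have PB : B \in orbits by rewrite -mem_enum mem_nth.
have /set0Pn[x Bx] : B != set0 by apply: contraNneq P0 => <-.
have Dx : x \in D by rewrite -covD; apply/bigcupP; exists B.
have /ffunP/(_ (exist _ x Dx)) := sum0; rewrite sum_ffunE ffunE.
rewrite (bigD1 i) //= big1 => [|j ne_ji].
  rewrite addr0 ffunE (nth_map set0) // orbit_vecE Bx => <-.
  by rewrite -[LHS]mulr1.
have lt_j : (j < size s)%N by rewrite -(size_map orbit_vec) ltn_ord.
rewrite ffunE (nth_map set0) // orbit_vecE /=.
case: (boolP (x \in _)) => [Bjx | _]; last exact: mulr0.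
case/eqP: ne_ji; apply/val_inj/eqP.
rewrite -(nth_uniq set0 lt_j lt_i) ?enum_uniq // -/B.
rewrite -(def_pblock tiP PB Bx) -(def_pblock tiP _ Bjx) //.
by rewrite -mem_enum mem_nth.
Qed.

Lemma orbit_vecsE : orbit_vecs F D H = [seq orbit_vec B | B <- enum orbits].
Proof. exact/undup_id/free_uniq/free_orbit_vecs. Qed.

(** The coordinates of a fixed vector are constant along each orbit. *)
Lemma fixed_subalg_span : fixed_subalg F D H = <<orbit_vecs F D H>>%VS.
Proof.
rewrite orbit_vecsE; apply/eqP; rewrite eqEsubv; apply/andP; split; last first.
  apply/span_subvP=> _ /mapP[B PB ->]; apply: orbit_vec_fixed.
  by rewrite mem_enum in PB.
have /and3P[/eqP covD tiP P0] := orbit_partition actsHD.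
apply/subvP=> u /fixed_subalgP fix_u.
(* The coordinate at x, extended by 0 from D to the whole group. *)
pose co x : F := if insub x is Some c then u c else 0.
have coE c : co (val c) = u c by rewrite /co valK.
have co_inv h x : h \in H -> x \in D -> co (h x) = co x.
  move=> Hh Dx; have Dhx : h x \in D by rewrite hD.
  rewrite -[x]/(val (exist (fun y => y \in D) x Dx)).
  rewrite -[h _]/(val (exist (fun y => y \in D) _ Dhx)) !coE.
  rewrite -[in LHS](fix_u h Hh) /mact sum_ffunE (bigD1 (exist _ x Dx)) //=.
  rewrite big1 => [|c ne]; rewrite !ffunE /=.
    by rewrite eqxx addr0; exact: mulr1.
  by rewrite (inj_eq perm_inj) eq_sym [val c == x](negPf ne); exact: mulr0.
have ->: u = \sum_(B in orbits) co (repr B) *: orbit_vec B.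
  transitivity (\sum_(x in D) co x *: mpt x).
    rewrite -[LHS]sum_mpt [RHS](eq_bigl [in [set x | x \in D]]) => [|x];
      last by rewrite inE.
    rewrite (reindex_omap (fun c : {x | x \in D} => val c) insub) /=
      => [|x]; last first.
      by rewrite inE => Dx; rewrite insubT.
    apply: eq_big => [c | c _]; first by rewrite inE (valP c) /= valK eqxx.
    by rewrite coE.
  rewrite [LHS](eq_bigl [in cover orbits]) => [|x]; last by rewrite covD.
  rewrite big_trivIset //; apply: eq_bigr => B.
  case/imsetP=> a Da ->; rewrite /orbit_vec scaler_sumr; apply: eq_bigr => x.
  have co_a y : y \in orbit 'P H a -> co y = co a.
    by case/orbitP=> h Hh <-; exact: co_inv.
  move=> ax; rewrite (co_a _ ax) (co_a (repr _)) //.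
  exact: mem_repr (orbit_refl _ _ _).
apply: rpred_sum => B PB; apply: rpredZ; apply: memv_span.
by apply: map_f; rewrite mem_enum.
Qed.

Lemma dim_fixed_subalg : \dim (fixed_subalg F D H) = #|orbits|.
Proof.
rewrite fixed_subalg_span orbit_vecsE.
by rewrite (eqP free_orbit_vecs) size_map -cardE.
Qed.

Lemma orbit_vec_inj (A B : {set gT}) :
  A \subset D -> B \subset D -> orbit_vec A = orbit_vec B -> A = B.
Proof.
move=> /subsetP sAD /subsetP sBD eqAB; apply/setP=> x.
have [Dx | Dx] := boolP (x \in D); last first.
  by rewrite (contraNF (sAD x) Dx) (contraNF (sBD x) Dx).
have := orbit_vecE A (exist _ x Dx); rewrite eqAB orbit_vecE /=.
by case: (x \in A); case: (x \in B) => // /eqP; rewrite ?(eq_sym 0) oner_eq0.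
Qed.

Lemma orbit_vec1 a : orbit_vec [set a] = mpt a.
Proof. by rewrite /orbit_vec big_set1. Qed.

Lemma orbit_vec2 a b : a != b -> orbit_vec [set a; b] = mpt a + mpt b.
Proof. by move=> ne_ab; rewrite /orbit_vec big_setU1 ?inE ?big_set1. Qed.

Lemma orbits_sub B : B \in orbits -> B \subset D.
Proof. by case/imsetP=> a Da ->; rewrite acts_sub_orbit. Qed.

Lemma is_singleE B :
  B \in orbits -> is_single H (orbit_vec B) = (#|B| == 1%N).
Proof.
move=> PB; have sBD := orbits_sub PB.
apply/exists_inP/idP=> [[a Da /andP[_ /eqP]] | /eqP B1].
  rewrite -orbit_vec1 => /orbit_vec_inj -> //; first by rewrite cards1.
  by rewrite sub1set.
case/imsetP: PB B1 => a Da -> /card_orbit1 orb_a; exists a => //.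
by rewrite orb_a eqxx orbit_vec1 /=.
Qed.

(** When no two distinct elements of an orbit have a product of order 3, there
    are no extras, and being a double is a matter of length only. *)
Lemma is_doubleE B :
    {in D, forall a b, b \in orbit 'P H a -> a != b -> #[a * b]%g != 3%N} ->
  B \in orbits -> is_double eta H (orbit_vec B) = (#|B| == 2%N).
Proof.
move=> no3 PB; have sBD := orbits_sub PB.
apply/exists_inP/idP=> [[a Da /exists_inP[b Db /and4P[ne_ab _ /eqP uB _]]] | ].
  move: uB; rewrite -orbit_vec2 // => /orbit_vec_inj -> //.
    by rewrite cards2 ne_ab.
  by apply/subsetP=> x /set2P[] ->.
case/cards2P=> a [b [ne_ab defB]].
have Da : a \in D by rewrite (subsetP sBD) // defB set21.
have Db : b \in D by rewrite (subsetP sBD) // defB set22.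
have orb_a : orbit 'P H a = [set a; b].
  have Ba : a \in B by rewrite defB set21.
  rewrite -defB; case/imsetP: PB Ba => x Dx -> ax; exact/orbit_eqP.
exists a => //; apply/exists_inP; exists b => //.
rewrite ne_ab orb_a defB orbit_vec2 // matsuo_mul_mpt // /pt_mul.
by rewrite (negPf ne_ab) (negPf (no3 a Da b _ _)) ?orb_a ?set22 ?eqxx.
Qed.

(** Used to turn the numbers of singles and of doubles into numbers of orbits
    of length one and two. *)
Lemma size_filter_orbit_vecs (p : pred M) (q : pred {set gT}) :
    {in orbits, forall B, p (orbit_vec B) = q B} ->
  size (filter p (orbit_vecs F D H)) = #|[set B in orbits | q B]|.
Proof.
move=> pq; rewrite orbit_vecsE filter_map size_map cardE.
have -> : enum [set B in orbits | q B] = filter q (enum orbits).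
  rewrite /enum_mem -filter_predI; apply: eq_filter => B.
  by rewrite /= inE andbC.
congr size; apply: eq_in_filter => B; rewrite mem_enum; exact: pq.
Qed.

End FixedSubalgebra.

Section Involution.

Variable tau : {perm gT}.
Hypotheses (tauD : forall x, x \in D -> tau x \in D) (tau2 : #[tau]%g = 2%N).

Local Notation H := <[tau]>%g.
Local Notation orbits := (orbit 'P H @: D).

Lemma acts_involution : [acts H, on D | 'P].
Proof.
rewrite gen_subG sub1set inE in_setT inE.
by apply/subsetP=> x Dx; rewrite inE; exact: tauD.
Qed.
Let actsH := acts_involution.

Lemma orbit_involution x : orbit 'P H x = [set x; tau x].
Proof.
rewrite /orbit; have -> : H = [set 1%g; tau] by rewrite cycle2g.
by rewrite imsetU1 imset_set1 /= /aperm perm1.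
Qed.

Lemma card_orbit_involution B : B \in orbits -> (#|B| == 2%N) = (#|B| != 1%N).
Proof. by case/imsetP=> x _ ->; rewrite orbit_involution cards2; case: (x != _). Qed.

Lemma card_singleton_orbits :
  #|[set B in orbits | #|B| == 1%N]| = #|[set x in D | tau x == x]|.
Proof.
rewrite -(card_imset [set x in D | tau x == x] (@set1_inj _)); apply: eq_card => B.
rewrite inE; apply/andP/imsetP=> [[/imsetP[x Dx ->]] | [x]].
  rewrite orbit_involution cards2 eqSS eqb0 negbK => /eqP tx; exists x.
    by rewrite inE Dx -tx eqxx.
  by rewrite -tx setUid.
rewrite inE => /andP[Dx /eqP tx] ->; rewrite cards1; split=> //.
by apply/imsetP; exists x => //; rewrite orbit_involution tx setUid.
Qed.

Lemma card_orbits_involution :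
  #|orbits| = (#|[set B in orbits | #|B| == 1%N]|
               + #|[set B in orbits | #|B| == 2%N]|)%N.
Proof.
rewrite -(cardsID [set B : {set gT} | #|B| == 1%N] orbits).
congr (_ + _)%N; apply: eq_card => B; rewrite !inE //.
by rewrite andbC; apply: andb_id2l => PB; rewrite card_orbit_involution.
Qed.

Lemma card_involution :
  #|D| = (#|[set B in orbits | #|B| == 1%N]|
          + 2 * #|[set B in orbits | #|B| == 2%N]|)%N.
Proof.
rewrite (card_partition (orbit_partition actsH)).
rewrite (bigID (fun B : {set gT} => #|B| == 1%N)) /= -!sum1dep_card big_distrr.
congr (_ + _)%N.
  by apply: eq_big => [B | B /andP[_ /eqP ->]].
apply: eq_big => [B | B /andP[PB]].
  by apply: andb_id2l => /card_orbit_involution.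
by rewrite -card_orbit_involution // => /eqP->.
Qed.

Hypothesis tauA : tau \in Aut [set: gT].
Hypothesis no3 : {in D, forall a, #[a * tau a]%g != 3%N}.

(** All orbits have length one or two and none gives an extra, so the generators
    of the flip subalgebra include a basis of the fixed subalgebra. *)
Lemma flip_subalg_fixed : flip_subalg eta D tau = fixed_subalg F D H.
Proof.
have [sXA _ minA] := subalg_genP eta (singles F D H ++ doubles eta D H).
have sHA : H \subset Aut [set: gT] by rewrite cycle_subG.
have no3' : {in D, forall a b, b \in orbit 'P H a -> a != b -> #[a * b]%g != 3%N}.
  by move=> a Da b; rewrite orbit_involution => /set2P[] ->; rewrite ?eqxx ?no3.
apply/eqP; rewrite eqEsubv; apply/andP; split.
  apply: minA; first exact: fixed_subalg_is_subalg.
  move=> u; rewrite mem_cat !mem_filter -andb_orl => /andP[_].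
  by rewrite orbit_vecsE // => /mapP[B]; rewrite mem_enum => PB ->;
     exact: orbit_vec_fixed.
rewrite fixed_subalg_span //; apply/span_subvP=> u Xu; apply: sXA.
rewrite mem_cat !mem_filter Xu !andbT.
move: Xu; rewrite orbit_vecsE // => /mapP[B]; rewrite mem_enum => PB ->.
by rewrite is_singleE // is_doubleE // card_orbit_involution // orbN.
Qed.

End Involution.

End Matsuo.

Lemma order_involution (T : finType) (p : {perm T}) :
  involutive p -> p != 1%g -> #[p]%g = 2%N.
Proof.
move=> pK p1; apply: nt_prime_order => //.
by apply/permP=> x; rewrite expgS expg1 permM perm1 pK.
Qed.

(** * The group G and its generators *)

Section Group.

Variable n : nat.
Local Notation VV := ('rV['F_2]_n * 'rV['F_2]_n)%type.
Implicit Types (u v : 'rV['F_2]_n) (w : VV) (s t : 'S_n) (e d : bool).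

Definition swap w : VV := (w.2, w.1).

Lemma in_UU w : (w \in UU n) = (w.1 \in Uset n) && (w.2 \in Uset n).
Proof. by case: w => u v; rewrite in_setX. Qed.

Lemma UU_swap w : (swap w \in UU n) = (w \in UU n).
Proof. by rewrite !in_UU andbC. Qed.

Lemma UU_vact w s : w \in UU n -> vact w s \in UU n.
Proof.
by rewrite !in_UU => /andP[U1 U2]; rewrite !U_act.
Qed.

Lemma UUactE w s : w \in UU n -> UUaction n w s = vact w s.
Proof. by move=> Uw; rewrite /= /actby Uw in_setT. Qed.

Lemma VV_mulE w w' : (w * w')%g = (w.1 + w'.1, w.2 + w'.2).
Proof. by []. Qed.

Lemma inUM : {in UU n &, {morph @inU n : w w' / (w * w')%g}}.
Proof. exact: sdpair1_morphM. Qed.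

Lemma inSM : {morph @inS n : s t / (s * t)%g}.
Proof. by move=> s t; apply: sdpair2_morphM; rewrite inE. Qed.

Lemma inU1 : inU 1%g = 1%g :> Gn n.
Proof. exact: morph1. Qed.

Lemma inS1 : inS 1%g = 1%g :> Gn n.
Proof. exact: morph1. Qed.

Lemma inSJ s t : inS (s ^ t)%g = (inS s ^ inS t)%g :> Gn n.
Proof.
exact: (morphJ (sdpair2_morphism (UUaction n)) (in_setT s) (in_setT t)).
Qed.

Lemma inUJ w s : w \in UU n -> inU (vact w s) = (inU w ^ inS s)%g.
Proof.
move=> Uw; rewrite -UUactE //.
exact: (@sdpair_act _ _ _ _ (UUaction n) w s Uw (in_setT s)).
Qed.

Lemma inU_inj : {in UU n &, injective (@inU n)}.
Proof. exact/injmP/injm_sdpair1. Qed.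

(** Every element of G is a product of an element of S_n and one of U_1 x U_2;
    the maps on G below are computed on these normal forms. *)
Lemma Gn_factor (x : Gn n) : exists s w, w \in UU n /\ x = (inS s * inU w)%g.
Proof.
case: (x) (sdpairE x) => [[s w] /= /setXP[_ Uw]] ->.
by exists s, w.
Qed.

Lemma inSU_M s w t w' : w \in UU n -> w' \in UU n ->
  ((inS s * inU w) * (inS t * inU w') = inS (s * t) * inU (vact w t * w'))%g.
Proof.
move=> Uw Uw'; rewrite inSM inUM ?UU_vact // inUJ // conjgE.
by rewrite !mulgA mulgK.
Qed.

Lemma inSU_val s w : w \in UU n ->
  (inS s * inU w : Gn n)%g = (s, w) :> ('S_n * VV).
Proof.
move=> Uw; have SUw : (s, w) \in setX [set: 'S_n] (UU n) by rewrite !inE in Uw *.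
pose x := SdPair (UUaction n) SUw.
by have <- : x = (inS s * inU w)%g by exact: sdpairE x.
Qed.

Definition root (i j : 'I_n) : 'rV['F_2]_n := evec i + evec j.

Definition rootVV e d i j : VV := (root i j *+ e, root i j *+ d).

(** The four elements of D attached to {i, j}: the bits are the exponents of
    e_i + e_j and f_i + f_j, so (0,0), (1,0), (0,1), (1,1) give b, c, d, e. *)
Definition transp e d i j : Gn n := (inU (rootVV e d i j) * inS (tperm i j))%g.

Lemma UU_rootVV e d i j : rootVV e d i j \in UU n.
Proof.
rewrite in_UU /= !inE.
by apply/andP; split; apply: rpredMn; have := evecD_U i j; rewrite inE.
Qed.

Lemma transpE e d i j :
  transp e d i j = if e then (if d then eG i j else cG i j)
                 else (if d then dG i j else bG i j).
Proof.
have U := UU_rootVV; rewrite /transp.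
case: e d => [] [] //; last first.
  by have -> : rootVV false false i j = 1%g :> VV by []; rewrite inU1 mul1g.
rewrite /eG -inUM; first congr (inU _ * _)%g.
  by rewrite VV_mulE /= addr0 add0r.
- exact: (U true false i j).
exact: (U false true i j).
Qed.

Lemma transpC e d i j : transp e d i j = transp e d j i.
Proof. by rewrite /transp /rootVV /root addrC tpermC. Qed.

Lemma vact_rootVV e d i j s : vact (rootVV e d i j) s = rootVV e d (s i) (s j).
Proof.
by case: e d => [] []; rewrite /vact /rootVV /root /= ?mul0mx ?mulmxDl ?evec_act.
Qed.

Lemma transpJ e d i j s : (transp e d i j ^ inS s)%g = transp e d (s i) (s j).
Proof.
rewrite /transp conjMg -inUJ ?UU_rootVV // vact_rootVV; congr (_ * _)%g.
by rewrite -tpermJ inSJ.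
Qed.

Lemma root_neq0 i j : i != j -> root i j != 0.
Proof.
move=> ne_ij; apply/eqP=> /rowP/(_ i); rewrite !mxE !eqxx (negPf ne_ij).
by rewrite addr0 => /eqP; rewrite oner_eq0.
Qed.

(** The points moved by a transposition are its two entries, and the order
    tells them apart. *)
Lemma tperm_ltn_inj (i j i' j' : 'I_n) :
  (i < j)%N -> (i' < j')%N -> tperm i j = tperm i' j' -> i = i' /\ j = j'.
Proof.
move=> lt_ij lt_ij' eq_t.
have moved x y z : tperm x y z != z -> z = x \/ z = y.
  by case: tpermP; auto; rewrite eqxx.
have /moved ci : tperm i' j' i != i by rewrite -eq_t tpermL eq_sym neq_ltn lt_ij.
have /moved cj : tperm i' j' j != j by rewrite -eq_t tpermR neq_ltn lt_ij.
case: ci cj lt_ij => -> [] ->; rewrite ?ltnn // => lt.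
by move: (ltn_trans lt lt_ij'); rewrite ltnn.
Qed.

Lemma transp_inj e d (i j : 'I_n) e' d' (i' j' : 'I_n) :
    (i < j)%N -> (i' < j')%N -> transp e d i j = transp e' d' i' j' ->
  [/\ e = e', d = d', i = i' & j = j'].
Proof.
move=> lt_ij lt_ij' eqr.
have [eqi eqj] : i = i' /\ j = j'.
  apply: tperm_ltn_inj => //; move: eqr.
  (* Move the permutation to the left, as in the underlying pairs of G. *)
  rewrite /transp conjgC (conjgC (inU _)).
  rewrite -!inUJ ?UU_rootVV // !vact_rootVV.
  move/(congr1 (fun x : sdprod_by (UUaction n) => (x : 'S_n * VV))).
  by rewrite !inSU_val ?UU_rootVV // => -[].
move: eqr; rewrite -eqi -eqj => /mulIg/inU_inj; rewrite !UU_rootVV.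
move=> /(_ isT isT)[].
have /root_neq0/eqP nz : i != j by rewrite neq_ltn lt_ij.
have inj_root (b c : bool) : root i j *+ b = root i j *+ c -> b = c.
  by case: b c => [] [] // h; case: nz; first [exact: h | exact: esym h].
by move=> /inj_root-> /inj_root->.
Qed.

Lemma mem_DG x :
  reflect (exists (i j : 'I_n) e d, (i < j)%N /\ x = transp e d i j)
          (x \in DG n).
Proof.
apply: (iffP bigcupP) => [[[i j] /= lt_ij] | [i [j [e [d [lt_ij ->]]]]]].
  rewrite !inE -!orbA => /or4P[] /eqP ->; exists i, j.
  - by exists false, false; rewrite transpE.
  - by exists true, false; rewrite transpE.
  - by exists false, true; rewrite transpE.
  by exists true, true; rewrite transpE.
exists (i, j) => //; rewrite transpE !inE /=.
by case: e d => [] []; rewrite eqxx ?orbT.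
Qed.

Lemma transp_DG e d i j : i != j -> transp e d i j \in DG n.
Proof.
rewrite neq_ltn => /orP[lt | lt]; apply/mem_DG; first by exists i, j, e, d.
by rewrite transpC; exists j, i, e, d.
Qed.

(** The square of 'I_n is the diagonal plus two triangles exchanged by
    reversing pairs. *)
Lemma card_ltn_pairs : (n + 2 * #|[set p : 'I_n * 'I_n | (p.1 < p.2)%N]| = n * n)%N.
Proof.
pose rev_pair (p : 'I_n * 'I_n) := (p.2, p.1).
have revK : involutive rev_pair by case.
rewrite -[in RHS](card_ord n) -card_prod -cardsT mul2n -addnn.
set L := [set p | _]; pose E := [set p : 'I_n * 'I_n | p.1 == p.2].
have cE : #|E| = n.
  rewrite -[RHS](card_ord n) -(@card_imset _ _ (fun i : 'I_n => (i, i)));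
    last by move=> i j [].
  apply: eq_card => -[i j]; rewrite inE /=.
  by apply/eqP/imsetP => [-> | [x _ [-> ->]]] //; exists j.
rewrite -{1}cE -{2}(card_preimset L (inv_inj revK)) -(cardsID E [set: _]) setTI.
congr (_ + _)%N; rewrite -(cardsID L (_ :\: E)); congr (_ + _)%N;
  apply: eq_card => -[i j].
  rewrite !inE /= -val_eqE /=; case: ltngtP => //.
by rewrite !inE /= -val_eqE /=; case: ltngtP.
Qed.

Lemma card_DG : #|DG n| = (4 * #|[set p : 'I_n * 'I_n | (p.1 < p.2)%N]|)%N.
Proof.
pose L := [set p : 'I_n * 'I_n | (p.1 < p.2)%N].
pose X (q : 'I_n * 'I_n * (bool * bool)) := transp q.2.1 q.2.2 q.1.1 q.1.2.
have -> : DG n = X @: setX L [set: bool * bool].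
  apply/setP=> x; apply/mem_DG/imsetP=> [[i [j [e [d [lt ->]]]]] | [[[i j] [e d]]]].
    by exists ((i, j), (e, d)); rewrite // in_setX !inE /= lt.
  by rewrite in_setX !inE andbT /= => lt ->; exists i, j, e, d.
rewrite card_in_imset => [|[[i j] [e d]] [[i' j'] [e' d']]].
  by rewrite cardsX cardsT card_prod card_bool mulnC.
by rewrite !in_setX !inE !andbT /= => lt lt' /transp_inj[] //= -> -> -> ->.
Qed.

(** * The automorphism exchanging U_1 and U_2 *)

Definition swapG (x : Gn n) : Gn n :=
  let p : 'S_n * VV := (x : sdprod_by (UUaction n)) in
  (inS p.1 * inU (swap p.2))%g.

Lemma swapGE s w : w \in UU n -> swapG (inS s * inU w) = (inS s * inU (swap w))%g.
Proof. by move=> Uw; rewrite /swapG inSU_val. Qed.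

Lemma swapGM : {morph swapG : x y / (x * y)%g}.
Proof.
move=> x y; have [s [w [Uw ->]]] := Gn_factor x.
have [t [w' [Uw' ->]]] := Gn_factor y.
by rewrite inSU_M // !swapGE ?groupM ?UU_vact // inSU_M ?UU_swap.
Qed.

Lemma swapGK : involutive swapG.
Proof.
move=> x; have [s [w [Uw ->]]] := Gn_factor x.
by rewrite !swapGE ?UU_swap //; case: (w).
Qed.

Definition tau1 : {perm Gn n} := perm (inv_inj swapGK).

Lemma tau1M x y : tau1 (x * y)%g = (tau1 x * tau1 y)%g.
Proof. by rewrite !permE swapGM. Qed.

Lemma tau1_inS s : tau1 (inS s) = inS s.
Proof. by rewrite permE -[inS s]mulg1 -inU1 swapGE. Qed.

Lemma tau1_inU w : w \in UU n -> tau1 (inU w) = inU (swap w).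
Proof. by move=> Uw; rewrite permE -[inU w]mul1g -inS1 swapGE // inS1 mul1g. Qed.

Lemma tau1_transp e d i j : tau1 (transp e d i j) = transp d e i j.
Proof. by rewrite /transp tau1M tau1_inS tau1_inU ?UU_rootVV. Qed.

Lemma tau1_Aut : tau1 \in Aut [set: Gn n].
Proof.
rewrite inE; apply/andP; split; first by apply/subsetP=> x; rewrite inE.
by apply/morphicP=> x y _ _; exact: tau1M.
Qed.

Lemma tau1J x y : tau1 (x ^ y)%g = (tau1 x ^ tau1 y)%g.
Proof.
have := morphJ (autm_morphism tau1_Aut) (in_setT x) (in_setT y).
by rewrite /= !autmE.
Qed.

Lemma tau1K : involutive tau1.
Proof. by move=> x; rewrite !permE swapGK. Qed.

Lemma tau1_rulesP : tau1_rules tau1.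
Proof.
move=> i j _; have := transpE; have T := tau1_transp.
by split; [have := T false false i j | have := T true false i j
  | have := T false true i j | have := T true true i j]; rewrite !transpE.
Qed.

(** Over the field of order 2 a linear combination of the spanning vectors is
    a sum of some of them, so additivity is all that an induction needs. *)
Lemma Uset_ind (P : 'rV['F_2]_n -> Prop) :
    P 0 -> (forall u v, u \in Uset n -> v \in Uset n -> P u -> P v -> P (u + v)) ->
    (forall i j : 'I_n, (i < j)%N -> P (root i j)) ->
  forall u, u \in Uset n -> P u.
Proof.
move=> P0 PD Proot u; rewrite inE => /coord_span ->.
set X := map_tuple _ _.
apply: (@proj2 (\sum_i coord X i u *: X`_i \in Uset n)).
apply: (big_ind (fun v => v \in Uset n /\ P v)) => [|v w [Uv Pv] [Uw Pw]|i _].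
- by split; first exact: group1.
- by split; [exact: (groupM Uv Uw) | exact: PD].
have /mapP[[a b]] : X`_i \in X by rewrite mem_nth ?size_tuple.
rewrite mem_enum inE /= => /eqP lt_ab ->.
have : (coord X i u == 0) || (coord X i u == 1).
  by case: (coord X i u) => [[|[|]]].
case/orP=> /eqP ->; first by rewrite scale0r; split; first exact: group1.
rewrite scale1r; split; first exact: evecD_U.
by apply: Proot; rewrite lt_ab.
Qed.

(** The transpositions generate S_n, and dividing an element of D by its
    transposition leaves a root; the roots generate U_1 and U_2. *)
Lemma DG_gen : <<DG n>>%g = [set: Gn n].
Proof.
have Dtransp e d (i j : 'I_n) : i != j -> transp e d i j \in <<DG n>>%g.
  by move=> ne; apply/mem_gen/transp_DG.
have DS s : inS s \in <<DG n>>%g.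
  have [ts -> /allP ts_ne] := prod_tpermP s.
  elim: ts ts_ne => [|t ts IH] ne; first by rewrite big_nil inS1 group1.
  rewrite big_cons inSM groupM //.
    have := Dtransp false false t.1 t.2 (ne t (mem_head _ _)).
    by rewrite transpE.
  by apply: IH => t' ts_t'; apply: ne; rewrite inE ts_t' orbT.
have DU e d i j : i != j -> inU (rootVV e d i j) \in <<DG n>>%g.
  move=> ne; rewrite -(mulgK (inS (tperm i j)) (inU _)).
  by rewrite groupM ?groupV ?DS // Dtransp.
have U0 : (0 : 'rV['F_2]_n) \in Uset n by rewrite inE mem0v.
have DU1 u : u \in Uset n -> inU (u, 0) \in <<DG n>>%g.
  move: u; apply: Uset_ind => [|u v Uu Uv|i j lt]; first by rewrite inU1 group1.
    move=> Du Dv; have -> : (u + v, 0) = (((u, 0) : VV) * ((v, 0) : VV))%g.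
      by rewrite VV_mulE addr0.
    by rewrite inUM ?in_UU ?Uu ?Uv ?groupM.
  by apply: (DU true false); rewrite neq_ltn lt.
have DU2 u : u \in Uset n -> inU (0, u) \in <<DG n>>%g.
  move: u; apply: Uset_ind => [|u v Uu Uv|i j lt]; first by rewrite inU1 group1.
    move=> Du Dv; have -> : (0, u + v) = (((0, u) : VV) * ((0, v) : VV))%g.
      by rewrite VV_mulE addr0.
    by rewrite inUM ?in_UU ?Uu ?Uv ?U0 ?groupM.
  by apply: (DU false true); rewrite neq_ltn lt.
apply/eqP; rewrite -subTset; apply/subsetP=> x _.
have [s [[u v] [+ ->]]] := Gn_factor x; rewrite in_UU /= => /andP[Uu Uv].
have -> : (u, v) = (((u, 0) : VV) * ((0, v) : VV))%g by rewrite VV_mulE addr0 add0r.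
by rewrite inUM ?in_UU ?Uu ?Uv ?U0 // !groupM ?DS ?DU1 ?DU2.
Qed.

(** The set where two endomorphisms agree is a subgroup, here containing the
    generating set D. *)
Lemma tau1_unique (f : {morphism [set: Gn n] >-> Gn n}) :
  tau1_rules f -> f =1 tau1.
Proof.
move=> rules x; pose E := [set x | f x == tau1 x].
have grpE : group_set E.
  apply/group_setP; split=> [|y z]; first by rewrite inE morph1 -inS1 tau1_inS.
  by rewrite !inE => /eqP fy /eqP fz; rewrite morphM ?inE // tau1M fy fz.
suff : <<DG n>>%g \subset Group grpE.
  by rewrite DG_gen => /subsetP/(_ x (in_setT x)); rewrite inE => /eqP.
rewrite gen_subG; apply/subsetP=> _ /mem_DG[i [j [e [d [lt ->]]]]].
rewrite inE tau1_transp; have [] := rules i j lt; rewrite !transpE.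
by case: e d => [] [] * ; apply/eqP.
Qed.

(** The four factors commute pairwise: U_1 x U_2 is abelian, and a vector fixed
    by a permutation commutes with it in the semidirect product. *)
Lemma inUS_commute w w' s t :
    w \in UU n -> w' \in UU n -> vact w t = w -> vact w' s = w' ->
    commute s t ->
  commute (inU w * inS s)%g (inU w' * inS t)%g.
Proof.
move=> Uw Uw' wt w's st.
have cUS z r : z \in UU n -> vact z r = z -> commute (inU z) (inS r).
  by move=> Uz zr; apply/commgP/conjg_fixP; rewrite -inUJ ?zr.
have cUU : commute (inU w) (inU w').
  by rewrite /commute -!inUM // !VV_mulE addrC [in X in (_, X)]addrC.
have cSS : commute (inS s) (inS t) by rewrite /commute -!inSM st.
have c1 := commuteM cUU (cUS w t Uw wt).
have c2 := commuteM (commute_sym (cUS w' s Uw' w's)) cSS.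
exact: commute_sym (commuteM (commute_sym c1) (commute_sym c2)).
Qed.

Lemma transp_sqr e d i j : (transp e d i j ^+ 2 = 1)%g.
Proof.
have fix_t : vact (rootVV e d i j) (tperm i j) = rootVV e d i j.
  by rewrite vact_rootVV tpermL tpermR /rootVV /root addrC.
have cUS : commute (inU (rootVV e d i j)) (inS (tperm i j)).
  by apply/commgP/conjg_fixP; rewrite -inUJ ?UU_rootVV ?fix_t.
rewrite expgMn // !expgS !expg0 !mulg1 -inSM tperm2 inS1 mulg1.
by rewrite -inUM ?UU_rootVV // VV_mulE !Defs.addvv inU1.
Qed.

Lemma transp_commute_same e d e' d' i j : commute (transp e d i j) (transp e' d' i j).
Proof.
by apply: inUS_commute;
  rewrite ?UU_rootVV // vact_rootVV tpermL tpermR /rootVV /root addrC.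
Qed.

Lemma transp_commute_disjoint e d i j e' d' i' j' :
    i != i' -> i != j' -> j != i' -> j != j' ->
  commute (transp e d i j) (transp e' d' i' j').
Proof.
move=> ii' ij' ji' jj'; apply: inUS_commute; rewrite ?UU_rootVV //.
- by rewrite vact_rootVV !tpermD // eq_sym.
- by rewrite vact_rootVV !tpermD // eq_sym.
by apply/commgP/conjg_fixP; rewrite tpermJ !tpermD // eq_sym.
Qed.

(** * The flip attached to a fixed-point-free involution of S_n *)

Section Flip.

Variable s : 'S_n.
Hypotheses (sK : involutive s) (s_free : forall i, s i != i).

Definition flip : {perm Gn n} := (tau1 * conj_aut [set: Gn n] (inS s))%g.

Lemma flipE x : flip x = (tau1 x ^ inS s)%g.
Proof. by rewrite permM conj_autE ?inE. Qed.

Lemma flip_transp e d i j : flip (transp e d i j) = transp d e (s i) (s j).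
Proof. by rewrite flipE tau1_transp transpJ. Qed.

Lemma flip_Aut : flip \in Aut [set: Gn n].
Proof. by rewrite groupM ?tau1_Aut ?Aut_aut. Qed.

Lemma flipK : involutive flip.
Proof.
move=> x; rewrite !flipE tau1J tau1K tau1_inS -conjgM -inSM.
have -> : (s * s = 1)%g by apply/permP=> i; rewrite permM perm1 sK.
by rewrite inS1 conjg1.
Qed.

Lemma order_tau1 (i j : 'I_n) : i != j -> #[tau1]%g = 2%N.
Proof.
rewrite neq_ltn => /orP[lt | lt]; apply: order_involution tau1K _.
  apply/eqP=> t1; have := tau1_transp true false i j; rewrite t1 perm1.
  by case/(transp_inj lt lt).
apply/eqP=> t1; have := tau1_transp true false j i; rewrite t1 perm1.
by case/(transp_inj lt lt).
Qed.

Lemma order_flip (i : 'I_n) : #[flip]%g = 2%N.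
Proof.
wlog lt : i / (i < s i)%N.
  move=> IH; have := s_free i; rewrite neq_ltn => /orP[lt | lt].
    by apply: (IH (s i)); rewrite sK.
  exact: IH lt.
apply: order_involution flipK _; apply/eqP=> f1.
(* The element c attached to a 2-cycle of s is sent to the corresponding d. *)
have := flip_transp true false i (s i); rewrite f1 perm1 sK [in RHS]transpC.
by case/(transp_inj lt lt).
Qed.

Lemma flip_DG x : x \in DG n -> flip x \in DG n.
Proof.
case/mem_DG=> i [j [e [d [lt ->]]]]; rewrite flip_transp transp_DG //.
by rewrite (inj_eq perm_inj) neq_ltn lt.
Qed.

(** A fixed-point-free involution s either exchanges i and j or maps {i, j} to
    a disjoint pair: s i cannot be i, and s i = j forces s j = i. *)
Lemma flip_commute x : x \in DG n -> commute x (flip x).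
Proof.
case/mem_DG=> i [j [e [d [lt ->]]]]; rewrite flip_transp.
have [-> | ne] := eqVneq j (s i).
  by rewrite sK transpC; exact: transp_commute_same.
have ne' : i != s j by rewrite -(inj_eq (inv_inj sK)) sK eq_sym.
by apply: transp_commute_disjoint; rewrite // eq_sym s_free.
Qed.

Lemma order_mul_flip : {in DG n, forall x, #[x * flip x]%g != 3%N}.
Proof.
move=> x Dx; have sqr y : y \in DG n -> (y ^+ 2 = 1)%g.
  by case/mem_DG=> i [j [e [d [_ ->]]]]; exact: transp_sqr.
have : (#[x * flip x]%g %| 2)%N.
  by rewrite order_dvdn expgMn ?sqr ?mulg1 ?flip_DG //; exact: flip_commute.
by apply: contraTneq => ->.
Qed.

(** Each 2-cycle of s contains exactly one i with i < s i. *)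
Lemma card_ltn_involution : (2 * #|[set i : 'I_n | (i < s i)%N]| = n)%N.
Proof.
rewrite mul2n -addnn -[RHS](card_ord n) -cardsT.
set L := [set i | _]; rewrite -(cardsID L [set: _]) setTI; congr (_ + _)%N.
rewrite -(card_preimset L (inv_inj sK)); apply: eq_card => i; rewrite !inE sK.
by have := s_free i; rewrite -val_eqE /=; case: ltngtP.
Qed.

(** Since flip maps transp e d i j to transp d e (s i) (s j), a fixed point has
    e = d and j = s i; it is given by a 2-cycle of s and a bit e. *)
Lemma card_flip_fixed : #|[set x in DG n | flip x == x]| = n.
Proof.
pose X (q : 'I_n * bool) := transp q.2 q.2 q.1 (s q.1).
pose L := setX [set i : 'I_n | (i < s i)%N] [set: bool].
have -> : [set x in DG n | flip x == x] = X @: L.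
  apply/setP=> x; rewrite inE; apply/andP/imsetP=> [[/mem_DG] | [[i e]]].
    case=> i [j [e [d [lt ->]]]]; rewrite flip_transp => /eqP eqr.
    have : s i != s j by rewrite (inj_eq perm_inj) neq_ltn lt.
    rewrite neq_ltn => /orP[lt_s | lt_s].
      by have [_ _ si] := transp_inj lt_s lt eqr; have := s_free i; rewrite si eqxx.
    move: eqr; rewrite transpC => /(transp_inj lt_s lt)[-> _ _ sij].
    exists (i, e); last by rewrite /X /= sij.
    by rewrite in_setX !inE sij andbT.
  rewrite in_setX !inE andbT /= => lt ->.
  rewrite transp_DG ?neq_ltn ?lt //; split=> //.
  by rewrite flip_transp /= sK transpC.
rewrite card_in_imset => [|[i e] [i' e']].
  by rewrite cardsX cardsT card_bool mulnC card_ltn_involution.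
by rewrite !in_setX !inE !andbT /= => lt lt' /transp_inj[] //= -> _ ->.
Qed.

End Flip.

End Group.

(** * The involution sigma *)

Section Sigma.

Variable k : nat.

(** The point 2j + b of {0, ..., 2k - 1}: the two elements of the j-th cycle of
    sigma differ in the bit b. *)
Definition pair_elt (j : 'I_k) (b : bool) : 'I_(2 * k) :=
  if b then Ordinal (dblS_lt j) else Ordinal (dbl_lt j).

Lemma val_pair_elt j b : pair_elt j b = (2 * j + b)%N :> nat.
Proof. by case: b => //=; rewrite addn0. Qed.

Lemma pair_eltP (i : 'I_(2 * k)) : exists j b, i = pair_elt j b.
Proof.
have lt_i : (i./2 < k)%N by have := ltn_ord i; lia.
exists (Ordinal lt_i), (odd i); apply: val_inj.
by rewrite /= val_pair_elt /=; lia.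
Qed.

(** The j-th factor of sigma flips the bit of the j-th pair and the other
    factors fix that pair; each index occurs once in the product. *)
Lemma sigma_pair_elt j b : sigma k (pair_elt j b) = pair_elt j (~~ b).
Proof.
pose t (a : 'I_k) := tperm (Ordinal (dbl_lt a)) (Ordinal (dblS_lt a)).
have t_elt a c : t a (pair_elt j c) = pair_elt j (c (+) (a == j)).
  have [-> | ne] := eqVneq a j.
    by case: c; rewrite /pair_elt /t /= (tpermL, tpermR).
  rewrite addbF /t tpermD // -val_eqE /= val_pair_elt;
    by move: ne; rewrite -val_eqE /=; case: c; lia.
have prod_t r : uniq r -> forall c,
    (\prod_(a <- r) t a)%g (pair_elt j c) = pair_elt j (c (+) (j \in r)).
  elim: r => [_ c | a r IH /= /andP[a_r /IH{}IH] c].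
    by rewrite big_nil perm1 addbF.
  rewrite big_cons permM t_elt IH inE -addbA eq_sym; congr (pair_elt j (c (+) _)).
  by case: eqP => // ->; rewrite (negPf a_r).
by rewrite /sigma prod_t ?index_enum_uniq ?mem_index_enum ?addbT.
Qed.

Lemma sigmaK : involutive (sigma k).
Proof. by move=> i; have [j [b ->]] := pair_eltP i; rewrite !sigma_pair_elt negbK. Qed.

Lemma sigma_free i : sigma k i != i.
Proof.
have [j [b ->]] := pair_eltP i; rewrite sigma_pair_elt -val_eqE /= !val_pair_elt.
by case: b; lia.
Qed.

End Sigma.

(** * The flip subalgebra of G *)

Theorem proposition3p8 (k : nat) (F : fieldType) (eta : F) :
  (2 <= k)%N -> 2%N \notin [pchar F] -> eta != 0 -> eta != 1 ->
  exists tau1 : {perm Gn (2 * k)},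
    let tau2 : {perm Gn (2 * k)} :=
      conj_aut [set: Gn (2 * k)] (inS (sigma k)) in
    let tau := (tau1 * tau2)%g in
    let H := <[tau]>%g in
    let D := DG (2 * k) in
    [/\ (* tau1 is the unique homomorphic extension of the rules *)
        tau1_rules tau1,
        forall f : {morphism [set: Gn (2 * k)] >-> Gn (2 * k)},
          tau1_rules f -> f =1 tau1,
        (* (i) *)
        [/\ tau1 \in Aut [set: Gn (2 * k)], #[tau1]%g = 2%N,
            tau \in Aut [set: Gn (2 * k)] & #[tau]%g = 2%N]
      & (* (ii) *)
        [/\ flip_subalg eta D tau = fixed_subalg F D H,
            \dim (flip_subalg eta D tau) = (4 * k ^ 2 - k)%N,
            size (singles F D H) = (2 * k)%N
          & size (doubles eta D H) = (4 * k ^ 2 - 3 * k)%N]].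
Proof.
move=> k_ge2 _ _ _; exists (tau1 (2 * k)).
rewrite -/(flip (sigma k)); cbv zeta.
set tau := flip (sigma k); set D := DG (2 * k).
have sK := @sigmaK k; have s_free := @sigma_free k.
have k_gt0 : (0 < k)%N by exact: ltnW.
pose i0 := pair_elt (Ordinal k_gt0) false.
have tau1_order : #[tau1 (2 * k)]%g = 2%N by exact: order_tau1 (s_free i0).
have tauA : tau \in Aut [set: Gn (2 * k)] := flip_Aut _.
have tau_order : #[tau]%g = 2%N := order_flip sK s_free i0.
have tauD x : x \in D -> tau x \in D := @flip_DG _ _ x.
have no3 : {in D, forall x, #[x * tau x]%g != 3%N} := order_mul_flip sK s_free.
have actsH := acts_involution tauD.
have flip_eq := flip_subalg_fixed eta tauD tau_order tauA no3.
have n_singles := card_singleton_orbits D tau_order.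
rewrite (card_flip_fixed sK s_free) in n_singles.
have := card_involution tauD tau_order; rewrite n_singles card_DG => card_eq.
have card_pairs := card_ltn_pairs (2 * k).
have n_doubles : #|[set B in orbit 'P <[tau]>%g @: D | #|B| == 2%N]|
    = (4 * k ^ 2 - 3 * k)%N.
  (* 8k^2 - 4k = 2k + 2N, with N the number of orbits of length two. *)
  have sqr : (2 * k * (2 * k) = 4 * k ^ 2)%N by rewrite -mulnn mulnACA.
  by move: card_eq card_pairs; rewrite sqr; lia.
split; [exact: tau1_rulesP | exact: tau1_unique | | split=> //].
  by split=> //; exact: tau1_Aut.
- rewrite flip_eq dim_fixed_subalg // card_orbits_involution //.
  have : (k <= k ^ 2)%N by rewrite -mulnn leq_pmulr.
  by rewrite n_singles n_doubles; lia.
- rewrite -[RHS]n_singles; apply: size_filter_orbit_vecs => // B.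
  exact: is_singleE.
rewrite -[RHS]n_doubles; apply: size_filter_orbit_vecs => // B.
apply: is_doubleE => // a Da b.
by rewrite orbit_involution // => /set2P[] ->; rewrite ?eqxx ?no3.
Qed.
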